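(* Let $A\in\mathbb{R}^{n\times n}$ be a symmetric matrix whose associated signed weighted undirected graph $\mathcal{G}(A)$ is connected and acyclic (a tree), and let $B=\mathbf{e}_1\in\mathbb{R}^n$, so that vertex $1$ is the only leader and the vertices $2,\dots,n$ are the followers. Suppose that all the followers have distance at most $2$ from the leader, with the $m_1$ followers at distance $1$ being $\mathcal{F}_1=[2,m_1+1]$ and the $m_2$ followers at distance $2$ being $\mathcal{F}_2=[m_1+2,m_1+m_2+1]$, $n=1+m_1+m_2$, and hence $$A=\begin{bmatrix} 0 & A_{12} & \mathbf{0}_{1\times m_2} \\ A_{21} & \mathbf{0}_{m_1\times m_1} & A_{23} \\ \mathbf{0}_{m_2\times1} & A_{32} & \mathbf{0}_{m_2\times m_2} \end{bmatrix},$$ where $A_{21}=A_{12}^\top\in\mathbb{R}^{m_1}$ and $A_{32}=A_{23}^\top\in\mathbb{R}^{m_2\times m_1}$. Then the pair $(A,B)$ is herdable if and only if for every $i,j\in[1,m_1]$ (including $i=j$) such that $$[A_{23}A_{32}]_{ii}=\sum_{k=1}^{m_2}\left([A_{32}]_{ki}\right)^2=\sum_{k=1}^{m_2}\left([A_{32}]_{kj}\right)^2=[A_{23}A_{32}]_{jj},$$ the following two conditions hold: (i) $[A_{21}]_i\cdot[A_{21}]_j>0$; (ii) $A_{32}(\mathbf{e}_i+\mathbf{e}_j)$ is either zero or unisigned.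
   Context: For integers $k\le n$, $[k,n]$ denotes the integer set $\{k,\dots,n\}$. $[M]_{ij}$ is the $(i,j)$ entry of $M$, $[\mathbf{v}]_i$ is the $i$-th entry of $\mathbf{v}$, and $\mathbf{e}_i$ is the $i$-th canonical basis vector (of the appropriate dimension). A nonzero vector is unisigned if all its nonzero entries have the same sign. $\mathcal{G}(A)$ has vertex set $[1,n]$ and an arc $(j,i)$ from $j$ to $i$, of weight $[A]_{ij}$, if and only if $[A]_{ij}\neq0$; for symmetric $A$ it is an undirected graph, and acyclicity excludes self-loops. Distance is the minimal length of a walk. In graph terms: index $i\in[1,m_1]$ corresponds to the $i$-th vertex of $\mathcal{F}_1$; the displayed equality says that the sum of squares of the weights of the edges from $i$ to $\mathcal{F}_2$ equals the corresponding sum for $j$; condition (i) says that the edges from the leader to $i$ and $j$ have the same sign; condition (ii) says that all edges from $i$ and $j$ to vertices in $\mathcal{F}_2$ have the same sign. Herdability: the pair $(A,B)$ describes the linear time-invariant system $\dot{\mathbf{x}}(t)=A\mathbf{x}(t)+B\mathbf{u}(t)$ (or its discrete-time counterpart $\mathbf{x}(t+1)=A\mathbf{x}(t)+B\mathbf{u}(t)$). The pair is (completely) herdable if for every $\mathbf{x}(0)$ and every $h>0$ there exist a time $t_f>0$ and an input $\mathbf{u}(t)$, $t\in[0,t_f)$, driving the state from $\mathbf{x}(0)$ to some $\mathbf{x}(t_f)\ge h\mathbf{1}_n$ (entrywise, $\mathbf{1}_n$ the all-ones vector). It is known that (in both continuous and discrete time) this is equivalent to the image (column space) of the controllability matrix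 $[B\,|\,AB\,|\,\cdots\,|\,A^{n-1}B]$ containing a vector all of whose entries are positive. *)

(* Defs.v *)
From mathcomp Require Import all_boot all_order all_algebra.
From mathcomp Require Import all_classical all_reals all_analysis.

Set Implicit Arguments.
Unset Strict Implicit.
Unset Printing Implicit Defensive.

Import Order.TTheory GRing.Theory Num.Theory.
Import numFieldNormedType.Exports.

Local Open Scope classical_set_scope.
Local Open Scope ring_scope.

(** * The graph of a matrix *)

Definition mx_arc (R : realType) (n : nat) (A : 'M[R]_n) : rel 'I_n :=
  fun j i => A i j != 0.

Definition graph_connected (T : finType) (e : rel T) : Prop :=
  forall x y : T, connect e x y.

(** For a symmetric [e], a single edge traversed back and forth is a [ucycle]
    of size 2, hence the bound on the size of genuine cycles. *)
Definition graph_acyclic (T : finType) (e : rel T) : Prop :=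
  (forall x : T, ~~ e x x) /\
  (forall c : seq T, (2 < size c)%N -> ~ ucycle e c).

Definition is_distance (T : finType) (e : rel T) (x y : T) (d : nat) : Prop :=
  (exists p : seq T, [/\ path e x p, last x p = y & size p = d]) /\
  (forall p : seq T, path e x p -> last x p = y -> (d <= size p)%N).

(** * Unisigned vectors *)

Definition unisigned (R : realType) (n : nat) (v : 'cV[R]_n) : Prop :=
  v != 0 /\
  (forall i j, v i 0 != 0 -> v j 0 != 0 -> Num.sg (v i 0) = Num.sg (v j 0)).

(** * Herdability *)

(** Inputs are integrable functions on [[0, tf[], and solutions of
    [x' = A x + B u] are taken in the sense of Caratheodory, i.e. [x] is
    continuous and satisfies the integrated equation. *)
Definition ct_solution (R : realType) (n p : nat) (A : 'M[R]_n)
    (B : 'M[R]_(n, p)) (tf : R) (x0 : 'cV[R]_n) (u : R -> 'cV[R]_p)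
    (x : R -> 'cV[R]_n) : Prop :=
  [/\ forall k : 'I_p, (@lebesgue_measure R).-integrable `[0, tf[
        (fun s : R => (u s k 0)%:E),
      forall i : 'I_n, {within `[0, tf], continuous (fun s : R => x s i 0)} &
      forall (t : R) (i : 'I_n), 0 <= t <= tf ->
        x t i 0 = x0 i 0 +
          \int[@lebesgue_measure R]_(s in `[0, t[)
             ((A *m x s + B *m u s) i 0)].

Definition ct_herdable (R : realType) (n p : nat) (A : 'M[R]_n)
    (B : 'M[R]_(n, p)) : Prop :=
  forall (x0 : 'cV[R]_n) (h : R), 0 < h ->
  exists (tf : R) (u : R -> 'cV[R]_p) (x : R -> 'cV[R]_n),
    [/\ 0 < tf, ct_solution A B tf x0 u x & forall i : 'I_n, h <= x tf i 0].

Definition dt_solution (R : realType) (n p : nat) (A : 'M[R]_n)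
    (B : 'M[R]_(n, p)) (tf : nat) (x0 : 'cV[R]_n) (u : nat -> 'cV[R]_p)
    (x : nat -> 'cV[R]_n) : Prop :=
  x 0%N = x0 /\
  (forall t : nat, (t < tf)%N -> x t.+1 = A *m x t + B *m u t).

Definition dt_herdable (R : realType) (n p : nat) (A : 'M[R]_n)
    (B : 'M[R]_(n, p)) : Prop :=
  forall (x0 : 'cV[R]_n) (h : R), 0 < h ->
  exists (tf : nat) (u : nat -> 'cV[R]_p) (x : nat -> 'cV[R]_n),
    [/\ (0 < tf)%N, dt_solution A B tf x0 u x & forall i : 'I_n, h <= x tf i 0].

(** * Vertices and blocks for the partition [1 + (m1 + m2)] *)

Definition leader (m1 m2 : nat) : 'I_(1 + (m1 + m2)) := lshift (m1 + m2) ord0.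

Definition follower1 (m1 m2 : nat) (i : 'I_m1) : 'I_(1 + (m1 + m2)) :=
  rshift 1 (lshift m2 i).

Definition follower2 (m1 m2 : nat) (k : 'I_m2) : 'I_(1 + (m1 + m2)) :=
  rshift 1 (rshift m1 k).

Definition block21 (R : realType) (m1 m2 : nat) (A : 'M[R]_(1 + (m1 + m2))) :
  'cV[R]_m1 := usubmx (dlsubmx A).

Definition block23 (R : realType) (m1 m2 : nat) (A : 'M[R]_(1 + (m1 + m2))) :
  'M[R]_(m1, m2) := ursubmx (drsubmx A).

Definition block32 (R : realType) (m1 m2 : nat) (A : 'M[R]_(1 + (m1 + m2))) :
  'M[R]_(m2, m1) := dlsubmx (drsubmx A).

Definition basis_vec (R : realType) (n : nat) (i : 'I_n) : 'cV[R]_n :=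
  delta_mx i 0.
Arguments basis_vec R {n} i.

(* Main.v *)
Require Import Defs.
From mathcomp Require Import all_boot all_order all_algebra.
From mathcomp Require Import all_classical all_reals all_analysis.
From mathcomp Require Import ring lra.

(** Why the criterion holds.

    The states that can be reached from the origin, in either time setting,
    form the Krylov space K = {p(A) b}, and herdability amounts to K
    containing a vector with positive entries: the motion from x0 is the free
    motion plus an element of K, and a large multiple of a positive element of
    K dominates the free motion (dt_herdableP, krylov_positive_ct).
    Conversely a motion from the origin never leaves K.  In discrete time this
    is immediate; in continuous time K is cut out by linear equations Q x = 0
    with Q A = M Q and Q b = 0 (krylov_equations), so y = Q x satisfies the
    integral form of y' = M y, y(0) = 0, and vanishes because |y|^2 exp(-ct)
    cannot increase (linear_integral_eq0).

    Steering to an element of K in continuous time is done with polynomial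
    inputs.  The vector b is reached by a flat output: with p the
    characteristic polynomial, the Cayley-Hamilton theorem turns the
    quotient of p(A) - p(d/dt) by A - d/dt, applied to a scalar polynomial f, into a
    trajectory driven by the input p(d/dt) f, and the derivatives of f at 0
    and 1 prescribe its endpoints (poly_steerable_gen).  Differentiating a
    trajectory multiplies its endpoint by A, up to a multiple of b
    (poly_steerableM).  The free motion is the power series of exp(tA) x0
    (free_solution).

    For a tree of depth two let a be the vector of weights at the leader and W
    the block of weights between the two layers of followers.  Each vertex of
    the second layer has exactly one neighbour in the first, so W^T W is
    diagonal, with the numbers d_i = sum_k W_ki^2 on the diagonal.  Hence K
    consists of the vectors (c, v, W w) where v and w range independently over
    the polynomials in diag(d) applied to a, that is, over the vectors
    proportional to a on each class of indices with equal d_i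
    (krylov_layers, krylov_layer1, krylov_layer2).  A positive v exists iff a
    has constant sign on each class, which is (i).  Then w has constant sign
    on each class, and W w > 0 asks that all edges going down from a class
    have the sign of w there, which is (ii) since the columns of W have
    disjoint supports.  Lagrange interpolation at the d_i realises any choice
    of one sign per class. *)
Set Implicit Arguments.
Unset Strict Implicit.
Unset Printing Implicit Defensive.

Import Order.TTheory GRing.Theory Num.Theory.
Local Open Scope ring_scope.

(** * Krylov subspaces *)

Section Krylov.
Variables (R : realType) (n' : nat).
Local Notation n := n'.+1.
Implicit Types (A : 'M[R]_n) (b x : 'cV[R]_n) (p : {poly R}).

Definition in_krylov A b x := exists p, x = horner_mx A p *m b.

Lemma in_krylov_gen A b : in_krylov A b b.
Proof. by exists 1; rewrite rmorph1 mul1mx. Qed.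

Lemma in_krylov0 A b : in_krylov A b 0.
Proof. by exists 0; rewrite rmorph0 mul0mx. Qed.

Lemma in_krylovD A b x y :
  in_krylov A b x -> in_krylov A b y -> in_krylov A b (x + y).
Proof. by move=> [p ->] [q ->]; exists (p + q); rewrite rmorphD mulmxDl. Qed.

Lemma in_krylovZ A b c x : in_krylov A b x -> in_krylov A b (c *: x).
Proof. by move=> [p ->]; exists (c *: p); rewrite linearZ /= scalemxAl. Qed.

Lemma in_krylov_sum A b (I : Type) (r : seq I) (F : I -> 'cV[R]_n) :
  (forall i, in_krylov A b (F i)) -> in_krylov A b (\sum_(i <- r) F i).
Proof.
move=> kF; elim/big_ind: _ => //; first exact: in_krylov0.
by move=> *; apply: in_krylovD.
Qed.

Lemma in_krylovM A b x : in_krylov A b x -> in_krylov A b (A *m x).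
Proof.
by move=> [p ->]; exists ('X * p); rewrite rmorphM /= horner_mx_X -mulmxA.
Qed.

Lemma in_krylovX A b k : in_krylov A b (A ^+ k *m b).
Proof. by exists 'X^k; rewrite rmorphXn /= horner_mx_X. Qed.

Lemma horner_mx_mulE A b p :
  horner_mx A p *m b = \sum_(k < size p) p`_k *: (A ^+ k *m b).
Proof.
rewrite -{1}[p]coefK poly_def raddf_sum /= mulmx_suml; apply: eq_bigr => k _.
by rewrite linearZ /= rmorphXn /= horner_mx_X -scalemxAl.
Qed.

Lemma in_krylov_ind A b (P : 'cV[R]_n -> Prop) :
  P b -> P 0 -> (forall x y, P x -> P y -> P (x + y)) ->
  (forall c x, P x -> P (c *: x)) -> (forall x, P x -> P (A *m x)) ->
  forall x, in_krylov A b x -> P x.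
Proof.
move=> Pb P0 PD PZ PM x [p ->]; rewrite horner_mx_mulE.
elim/big_ind: _ => // k _; apply: PZ.
by elim: (k : nat) => [|j IH]; rewrite ?mul1mx // exprS -mulmxA; apply: PM.
Qed.

(** The degree of the minimal polynomial bounds the number of powers needed,
    which makes the Krylov space the row space of a matrix. *)
Definition krylov_mx A b : 'M[R]_(degree_mxminpoly A, n) :=
  \matrix_(k < degree_mxminpoly A) (A ^+ k *m b)^T.

Lemma in_krylovP A b x : in_krylov A b x <-> (x^T <= krylov_mx A b)%MS.
Proof.
split=> [[p ->]|/submxP[u xE]].
  have -> : horner_mx A p = horner_mx A (p %% mxminpoly A).
    rewrite {1}(Pdiv.IdomainMonic.divp_eq (mxminpoly_monic A) p).
    by rewrite rmorphD rmorphM /= mx_root_minpoly mulr0 add0r.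
  rewrite horner_mx_mulE linear_sum /=; apply: summx_sub => k _.
  rewrite linearZ /= scalemx_sub //.
  have kd := leq_trans (ltn_ord k) (size_mod_mxminpoly A p).
  by apply: (eq_row_sub (Ordinal kd)); rewrite rowK.
have -> : x = \sum_k u 0 k *: (A ^+ k *m b).
  apply: (can_inj trmxK); rewrite xE mulmx_sum_row linear_sum /=.
  by apply: eq_bigr => k _; rewrite linearZ /= rowK.
by apply: in_krylov_sum => k; apply/in_krylovZ/in_krylovX.
Qed.

(** An invariant subspace containing b is described by equations on which the
    control has no influence and whose residual Q x obeys an autonomous linear
    equation.  The rows of Q span the annihilator of the Krylov space;
    the invariance of the space under A gives that of its annihilator, and the
    last clause is biduality. *)
Lemma krylov_equations A b : exists Q M : 'M[R]_n,
  [/\ Q *m A = M *m Q, Q *m b = 0 &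
      forall x, Q *m x = 0 -> in_krylov A b x].
Proof.
pose C := krylov_mx A b; pose Q := kermx C^T.
have QC : Q *m C^T = 0 by apply: mulmx_ker.
have QK x : in_krylov A b x -> Q *m x = 0.
  move/in_krylovP/submxP=> [u xE].
  by rewrite -[x]trmxK xE trmx_mul mulmxA QC mul0mx.
have /submxP[N CA] : (C *m A^T <= C)%MS.
  apply/row_subP => k; rewrite row_mul rowK -trmx_mul.
  exact/in_krylovP/in_krylovM/in_krylovX.
have /submxP[M QA] : (Q *m A <= Q)%MS.
  apply/sub_kermxP; rewrite -mulmxA -[A *m _]trmxK trmx_mul trmxK CA.
  by rewrite trmx_mul mulmxA QC mul0mx.
exists Q, M; split=> // [|x Qx]; first exact/QK/in_krylov_gen.
apply/in_krylovP; rewrite submxE.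
have /submxP[L CL] : ((cokermx C)^T <= Q)%MS.
  by apply/sub_kermxP; rewrite -trmx_mul mulmx_coker trmx0.
by rewrite -[cokermx C]trmxK -trmx_mul CL -mulmxA Qx mulmx0 trmx0.
Qed.

Definition krylov_positive A b :=
  exists2 x, in_krylov A b x & forall i, 0 < x i 0.

(** This is what makes the initial state irrelevant for herdability. *)
Lemma pos_scaling (w z : 'cV[R]_n) (h : R) : (forall i, 0 < w i 0) ->
  exists c : R, forall i, h <= z i 0 + c * w i 0.
Proof.
move=> w_gt0; pose c := \sum_i (`|h - z i 0| / w i 0); exists c => i.
have ci : `|h - z i 0| / w i 0 <= c.
  rewrite /c (bigD1 i) //= lerDl sumr_ge0 // => j _.
  by rewrite divr_ge0 // ltW.
rewrite -lerBlDl (le_trans (ler_norm _)) //.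
by rewrite -ler_pdivrMr.
Qed.

(** The state reached from x0 after N steps is A^N x0 plus the Krylov vector
    whose polynomial has the inputs, in reverse order, as coefficients. *)
Lemma dt_herdableP A b : dt_herdable A b <-> krylov_positive A b.
Proof.
split=> [herd|[w [p wE] w_gt0] x0 h h_gt0].
  have [tf [u [x [_ [x0 xS] xh]]]] := herd 0 1 ltr01.
  exists (x tf) => [|i]; last exact: lt_le_trans ltr01 (xh i).
  have: (tf <= tf)%N by [].
  elim: {1 3}tf => [_|t IH lt_t]; first by rewrite x0; apply: in_krylov0.
  rewrite xS //; apply: in_krylovD; first exact/in_krylovM/IH/ltnW.
  rewrite [u t]mx11_scalar mul_mx_scalar.
  exact/in_krylovZ/in_krylov_gen.
(* The extra step makes N positive even when p = 0. *)
pose N := (size p).+1.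
have [c hc] := pos_scaling (A ^+ N *m x0) h w_gt0.
pose v k : R := c * p`_(N - k.+1).
pose x := fix x t : 'cV[R]_n :=
  if t is s.+1 then A *m x s + b *m (v s)%:M else x0.
exists N, (fun t => (v t)%:M), x; split=> // i.
have xE t : x t = A ^+ t *m x0 + \sum_(k < t) v k *: (A ^+ (t - k.+1) *m b).
  have AS k : A *m A ^+ k = A ^+ k.+1 by rewrite exprS.
  elim: t => [|t IH]; first by rewrite big_ord0 addr0 mul1mx.
  rewrite /= IH big_ord_recr /= mulmxDr mulmxA AS.
  rewrite subnn mul1mx mul_mx_scalar addrA; congr (_ + _ + _).
  rewrite mulmx_sumr; apply: eq_bigr => k _.
  by rewrite -scalemxAr mulmxA AS subSS -subSn.
suff xN : x N = A ^+ N *m x0 + c *: w by rewrite xN [leRHS]mxE [X in _ + X]mxE.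
rewrite xE wE horner_mx_mulE scaler_sumr (reindex_inj rev_ord_inj) /=.
have revK k : (k <= size p)%N -> (N - (N - k.+1).+1)%N = k.
  move=> kp; have kN : (k < N)%N by [].
  by rewrite subnSK // subKn // ltnW.
rewrite big_ord_recr /= /v [in p`_(_ - (_ - (size p).+1).+1)]revK //.
rewrite nth_default // mulr0 scale0r addr0; congr (_ + _); apply: eq_bigr => k _.
by rewrite !revK ?scalerA // ltnW.
Qed.

End Krylov.

(** * Polynomial trajectories *)

(** Each derivative lowers by one the order of vanishing at t, and the value
    of the cofactor is known: this gives both the vanishing derivatives of the
    flat output at its endpoints and the first nonzero one. *)
Lemma derivn_mul_XsubC_exp (F : idomainType) (g : {poly F}) (t : F) (m k : nat) :
  exists2 h, (g * ('X - t%:P) ^+ (m + k))^`(k) = h * ('X - t%:P) ^+ m &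
    h.[t] = g.[t] *+ (m + k) ^_ k.
Proof.
elim: k g => [|k IH] g; first by exists g; rewrite ?addn0 ?ffactn0.
pose g1 := g^`() * ('X - t%:P) + g *+ (m + k).+1.
have [h hE ht] := IH g1; exists h; last first.
  rewrite ht /g1 hornerD hornerM hornerXsubC subrr mulr0 add0r hornerMn.
  by rewrite -mulrnA addnS ffactSS.
rewrite derivSn -hE; congr (_^`(_)); rewrite derivM deriv_exp derivXsubC mul1r.
by rewrite addnS /= exprS mulrA /g1 mulrDl mulrnAl mulrnAr.
Qed.

Section PolynomialSteering.
Variables (R : realType) (n' : nat).
Local Notation n := n'.+1.
Variables (A : 'M[R]_n) (b : 'cV[R]_n).

Definition poly_trajectory (y : 'cV[{poly R}]_n) (u : {poly R}) : Prop :=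
  map_mx (@deriv R) y = map_mx polyC A *m y + u *: map_mx polyC b.

(** The input is required to vanish to order N at time 0 so that a trajectory
    can be differentiated N times and still start from the origin. *)
Definition poly_steerable (N : nat) (w : 'cV[R]_n) : Prop :=
  exists y v, [/\ poly_trajectory y (v * 'X^N),
    forall i, (y i 0).[0] = 0 & forall i, (y i 0).[1] = w i 0].

Lemma poly_trajectory_horner y u t i : poly_trajectory y u ->
  (y i 0)^`().[t] = (A *m map_mx (horner^~ t) y + u.[t] *: b) i 0.
Proof.
move=> yE; have -> : (y i 0)^`() = (map_mx (@deriv R) y) i 0 by rewrite mxE.
rewrite yE !mxE hornerD hornerM hornerC horner_sum; congr (_ + _).
by apply: eq_bigr => k _; rewrite !mxE hornerM hornerC.
Qed.

Lemma poly_steerable0 N : poly_steerable N 0.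
Proof.
exists 0, 0; split=> [|i|i]; rewrite ?mxE ?horner0 //.
by rewrite /poly_trajectory mulmx0 mul0r scale0r addr0 raddf0.
Qed.

Lemma poly_steerableD N w w' :
  poly_steerable N w -> poly_steerable N w' -> poly_steerable N (w + w').
Proof.
move=> [y [v [yE y0 y1]]] [y' [v' [yE' y0' y1']]].
exists (y + y'), (v + v'); split=> [|i|i]; last 2 first.
- by rewrite mxE hornerD y0 y0' addr0.
- by rewrite !mxE hornerD y1 y1'.
rewrite /poly_trajectory map_mxD yE yE' mulmxDr mulrDl scalerDl.
by rewrite addrACA.
Qed.

Lemma poly_steerableZ N c w : poly_steerable N w -> poly_steerable N (c *: w).
Proof.
move=> [y [v [yE y0 y1]]].
exists (c%:P *: y), (c%:P * v); split=> [|i|i]; last 2 first.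
- by rewrite mxE hornerM y0 mulr0.
- by rewrite !mxE hornerM y1 hornerC.
rewrite /poly_trajectory -mulrA -scalerA -scalemxAr -scalerDr -yE.
by apply/matrixP => i j; rewrite !mxE mul_polyC derivZ mul_polyC.
Qed.

Lemma deriv_mulmx_polyC (y : 'cV[{poly R}]_n) :
  map_mx (@deriv R) (map_mx polyC A *m y) =
  map_mx polyC A *m map_mx (@deriv R) y.
Proof.
apply/matrixP => i j; rewrite !mxE raddf_sum; apply: eq_bigr => k _.
by rewrite !mxE /= mul_polyC derivZ mul_polyC.
Qed.

Lemma deriv_scale_polyC (u : {poly R}) :
  map_mx (@deriv R) (u *: map_mx polyC b) = u^`() *: map_mx polyC b.
Proof.
by apply/matrixP => i j; rewrite !mxE derivM derivC mulr0 addr0.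
Qed.

Lemma poly_trajectory_deriv y u :
  poly_trajectory y u -> poly_trajectory (map_mx (@deriv R) y) u^`().
Proof.
rewrite /poly_trajectory => {1}->.
by rewrite raddfD /= deriv_mulmx_polyC deriv_scale_polyC.
Qed.

(** The derivative of a trajectory y with input u is a trajectory with input
    u'.  It starts at A y(0) + u(0) b = 0 and ends at A w + u(1) b; the second
    term is removed with a trajectory that reaches b. *)
Lemma poly_steerableM N w :
  poly_steerable N b -> poly_steerable N.+1 w -> poly_steerable N (A *m w).
Proof.
move=> sb [y [v [yE y0 y1]]]; pose u1 := v.[1].
rewrite -[A *m w](addrK (u1 *: b)) -scaleNr.
apply: poly_steerableD; last exact: poly_steerableZ.
exists (map_mx (@deriv R) y), (v^`() * 'X + v *+ N.+1); split=> [|i|i].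
- have <- : (v * 'X^(N.+1))^`() = (v^`() * 'X + v *+ N.+1) * 'X^N.
    by rewrite derivM derivXn /= mulrDl -mulrA -exprS mulrnAl mulrnAr.
  exact: poly_trajectory_deriv.
- rewrite mxE (poly_trajectory_horner _ _ yE) hornerM hornerXn expr0n mulr0.
  rewrite scale0r addr0 mxE big1 // => k _.
  by rewrite mxE y0 mulr0.
rewrite mxE (poly_trajectory_horner _ _ yE) hornerM hornerXn expr1n mulr1.
suff -> : map_mx (horner^~ 1) y = w by [].
by apply/matrixP => k j; rewrite (ord1 j) mxE y1.
Qed.

(** Flatness of the controllable part.  T k stands for
    sum_(j < k) f^(j) A^(k-1-j) b, so that T_traj telescopes, and combining
    the T k with the coefficients of the characteristic polynomial kills the
    terms in f A^k b. *)
Lemma poly_steerable_gen N : poly_steerable N b.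
Proof.
(* The input involves f^(k) for k <= n, hence the order n + N at 0.  The order
   n' = n - 1 at 1 makes T n, whose coefficient is 1, the only T k that does
   not vanish there; T n takes the value f^(n')(1) b. *)
pose f : {poly R} := ('X^(n + N)) * ('X - 1%:P) ^+ n'.
pose T := fix T k : 'cV[{poly R}]_n := if k is k'.+1
  then map_mx polyC A *m T k' + f^`(k') *: map_mx polyC b else 0.
have T_traj k : map_mx (@deriv R) (T k) = map_mx polyC A *m T k +
    f^`(k) *: map_mx polyC b - f *: map_mx polyC (A ^+ k *m b).
  elim: k => [|k IH]; first by rewrite mulmx0 add0r mul1mx subrr raddf0.
  rewrite [T k.+1]/= raddfD /= deriv_mulmx_polyC deriv_scale_polyC IH.
  rewrite exprS -mulmxA [in RHS]map_mxM mulmxBr -scalemxAr.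
  by rewrite addrAC -derivnS.
have T_eq0 k t i : (forall j, (j < k)%N -> f^`(j).[t] = 0) -> (T k i 0).[t] = 0.
  elim: k i => [|k IH] i fj; first by rewrite mxE horner0.
  rewrite !mxE hornerD hornerM fj // mul0r addr0 horner_sum big1 // => l _.
  by rewrite hornerM IH ?mulr0 // => j jk; rewrite fj // ltnW.
have f1 j : (j < n')%N -> f^`(j).[1] = 0.
  move=> jn; have [h hE _] := derivn_mul_XsubC_exp (F := R) 'X^(n + N) 1 (n' - j) j.
  rewrite /f -{2}(subnK (ltnW jn)) hE hornerM horner_exp hornerXsubC subrr.
  by rewrite expr0n subn_eq0 leqNgt jn mulr0.
have f1n : f^`(n').[1] = n'`!%:R.
  have [h + h1] := derivn_mul_XsubC_exp (F := R) 'X^(n + N) 1 0 n'.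
  by rewrite add0n expr0 mulr1 /f => ->; rewrite h1 hornerXn expr1n ffactnn.
have fX j : (j <= n)%N -> exists h, f^`(j) = h * 'X^(n - j + N).
  move=> jn.
  have [h hE _] := derivn_mul_XsubC_exp (F := R) (('X - 1%:P) ^+ n') 0 (n - j + N) j.
  rewrite subr0 in hE; exists h; rewrite -hE /f mulrC.
  by rewrite addnAC subnK.
have f0 j : (j < n)%N -> f^`(j).[0] = 0.
  move=> jn; have [h ->] := fX j (ltnW jn).
  by rewrite hornerM hornerXn expr0n addn_eq0 subn_eq0 leqNgt jn mulr0.
pose p := char_poly A.
have pn : p`_n = 1.
  by have /monicP := char_poly_monic A; rewrite lead_coefE size_char_poly.
have CH : \sum_(k < n.+1) p`_k *: (A ^+ k *m b) = 0.
  have := horner_mx_mulE A b p; rewrite size_char_poly => <-.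
  by rewrite Cayley_Hamilton mul0mx.
pose y := \sum_(k < n.+1) (p`_k)%:P *: T k.
have yE i t : (y i 0).[t] = \sum_(k < n.+1) p`_k * (T k i 0).[t].
  rewrite summxE horner_sum; apply: eq_bigr => k _.
  by rewrite mxE hornerM hornerC.
have y_traj : poly_trajectory y (\sum_(k < n.+1) (p`_k)%:P * f^`(k)).
  have dZ c (z : 'cV[{poly R}]_n) :
      map_mx (@deriv R) (c%:P *: z) = c%:P *: map_mx (@deriv R) z.
    by apply/matrixP => i j; rewrite !mxE !mul_polyC derivZ.
  rewrite /poly_trajectory raddf_sum /=.
  under eq_bigr do rewrite dZ T_traj scalerBr scalerDr scalemxAr scalerA.
  rewrite sumrB big_split /= -mulmx_sumr -scaler_suml -[RHS]subr0.
  congr (_ - _); transitivity (f *: map_mx polyC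
      (\sum_(k < n.+1) p`_k *: (A ^+ k *m b))); last first.
    by rewrite CH raddf0 scaler0.
  rewrite raddf_sum scaler_sumr; apply: eq_bigr => k _ /=.
  by rewrite map_mxZ !scalerA mulrC.
have [v vE] : exists v, \sum_(k < n.+1) (p`_k)%:P * f^`(k) = v * 'X^N.
  elim/big_ind: _ => [|_ _ [v ->] [v' ->]|k _]; first by exists 0; rewrite mul0r.
    by exists (v + v'); rewrite mulrDl.
  have [h ->] := fX k (leq_ord k).
  by exists ((p`_k)%:P * (h * 'X^(n - k))); rewrite exprD !mulrA.
have fact_unit : (n'`!)%:R != 0 :> R by rewrite pnatr_eq0 -lt0n fact_gt0.
rewrite -[b](scalerK fact_unit); apply: poly_steerableZ.
exists y, v; split=> [|i|i]; first by rewrite -vE.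
- rewrite yE big1 // => k _; rewrite T_eq0 ?mulr0 // => j jk; apply: f0.
  by rewrite (leq_trans jk) // leq_ord.
rewrite yE big_ord_recr /= pn mul1r big1 ?add0r => [|k _]; last first.
  rewrite T_eq0 ?mulr0 // => j jk; apply: f1.
  by rewrite (leq_trans jk) // -ltnS.
rewrite [LHS](_ : _ = (f^`(n') * (b i 0)%:P).[1]).
  by rewrite hornerM hornerC f1n mxE.
rewrite !mxE hornerD horner_sum big1 ?add0r // => k _.
by rewrite hornerM T_eq0 ?mulr0.
Qed.

Lemma krylov_poly_steerable w : in_krylov A b w -> poly_steerable 0 w.
Proof.
suff sX : forall k N, poly_steerable N (A ^+ k *m b).
  move=> [q ->]; rewrite horner_mx_mulE; elim/big_ind: _ => [|x x'|k _].
  - exact: poly_steerable0.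
  - exact: poly_steerableD.
  - exact: poly_steerableZ.
elim=> [|k IH] N; first by rewrite mul1mx; apply: poly_steerable_gen.
by rewrite exprS -mulmxA; apply: poly_steerableM; first exact: poly_steerable_gen.
Qed.

End PolynomialSteering.

(** * Free motion *)

Section FreeSolution.
Import numFieldNormedType.Exports.
Local Open Scope classical_set_scope.
Variables (R : realType) (n' : nat).
Local Notation n := n'.+1.
Variable (A : 'M[R]_n).

(** Coefficients of the i-th coordinate of exp(tA) v as a power series in t. *)
Definition exp_coord (v : 'cV[R]_n) (i : 'I_n) : R^nat :=
  fun k => (A ^+ k *m v) i 0 / k`!%:R.

(** Differentiating exp(tA) v replaces v by A v, so the sequences of
    coefficients form a family stable under formal derivation and one
    convergence lemma serves for all derivatives. *)
Lemma exp_coord_diffs v i :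
  pseries_diffs (exp_coord v i) = exp_coord (A *m v) i.
Proof.
apply/funext => k; rewrite /pseries_diffs /exp_coord exprSr -mulmxA.
by rewrite factS natrM invfM mulrCA mulVKf ?pnatr_eq0.
Qed.

Lemma exp_coord_mul v i k :
  exp_coord (A *m v) i k = \sum_j A i j * exp_coord v j k.
Proof.
rewrite /exp_coord mulmxA [A ^+ k *m A](_ : _ = A ^+ k.+1) ?exprSr //.
rewrite -exprSr exprS -mulmxA mxE mulr_suml.
by apply: eq_bigr => j _; rewrite mulrA.
Qed.

(** In the l1 norm A has operator norm at most the sum c of the absolute
    values of its entries, which gives domination by the series of
    exp(c |t|). *)
Lemma is_cvg_exp_coord v i t : cvgn (pseries (exp_coord v i) t).
Proof.
pose N1 (x : 'cV[R]_n) : R := \sum_j `|x j 0|.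
pose c : R := \sum_j \sum_l `|A j l|.
have N1M x : N1 (A *m x) <= c * N1 x.
  rewrite mulr_suml; apply: ler_sum => j _; rewrite mxE.
  rewrite (le_trans (ler_norm_sum _ _ _)) // mulr_suml; apply: ler_sum => l _.
  rewrite normrM ler_wpM2l // /N1 (bigD1 l) //= lerDl sumr_ge0 //.
have c0 : 0 <= c by do 2 (apply: sumr_ge0 => ? _).
have bnd k : `|(A ^+ k *m v) i 0| <= c ^+ k * N1 v.
  apply: (@le_trans _ _ (N1 (A ^+ k *m v))).
    by rewrite /N1 (bigD1 i) //= lerDl sumr_ge0.
  elim: k => [|k IH]; first by rewrite mul1mx mul1r.
  by rewrite exprS -mulmxA (le_trans (N1M _)) // exprS -mulrA ler_wpM2l.
apply: normed_cvg.
apply: (@series_le_cvg _ _ (N1 v *: exp_coeff (c * `|t|))).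
- by move=> k /=; rewrite normr_ge0.
- move=> k; rewrite mulr_ge0 ?sumr_ge0 //.
  by rewrite divr_ge0 // exprn_ge0 // mulr_ge0.
- move=> k /=; rewrite /exp_coord !normrM normfV normrX normr_nat.
  rewrite [leRHS](_ : _ = c ^+ k * N1 v / k`!%:R * `|t| ^+ k).
    by rewrite ler_wpM2r ?exprn_ge0 // ler_wpM2r.
  rewrite -[LHS]/(N1 v * ((c * `|t|) ^+ k / k`!%:R)) exprMn.
  by rewrite mulrA mulrAC mulrCA !mulrA.
exact/is_cvg_seriesZ/is_cvg_series_exp_coeff.
Qed.

Lemma free_solution (v : 'cV[R]_n) : exists z : R -> 'cV[R]_n, z 0 = v /\
  forall (t : R) (i : 'I_n),
    is_derive t (1 : R) (fun s : R => z s i 0 : R) ((A *m z t) i 0).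
Proof.
exists (fun t => \col_i limn (pseries (exp_coord v i) t)); split.
  apply/matrixP => i j; rewrite (ord1 j) mxE; apply/cvg_lim => //.
  rewrite -cvg_shiftS (_ : (fun m => _) = cst (v i 0)); first exact: cvg_cst.
  apply/funext => m; rewrite /pseries /series /= big_nat_recl //= big1.
    by rewrite /exp_coord mul1mx fact0 divr1 expr0 mulr1 addr0.
  by move=> k _; rewrite exprS mul0r mulr0.
move=> t i; rewrite [X in is_derive _ _ X](_ : _ =
    (fun s => limn (pseries (exp_coord v i) s))); last first.
  by apply/funext => s; rewrite mxE.
have -> : (A *m \col_i limn (pseries (exp_coord v i) t)) i 0 =
    limn (pseries (pseries_diffs (exp_coord v i)) t).
  apply/esym/cvg_lim => //; rewrite exp_coord_diffs mxE.
  rewrite (_ : pseries _ _ = fun m => \sum_j A i j * pseries (exp_coord v j) t m).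
    apply: cvg_big => [|j _]; first exact: add_continuous.
    rewrite mxE; apply: cvgMr.
    exact: is_cvg_exp_coord.
  apply/funext => m; rewrite /pseries /series /=.
  under [RHS]eq_bigr do rewrite mulr_sumr.
  rewrite exchange_big; apply: eq_bigr => k _.
  by rewrite exp_coord_mul mulr_suml; apply: eq_bigr => j _; rewrite mulrA.
(* Any point of modulus larger than |t| would do. *)
apply: (@pseries_snd_diffs _ _ (`|t| + 1)); rewrite ?exp_coord_diffs.
- exact: is_cvg_exp_coord.
- exact: is_cvg_exp_coord.
- exact: is_cvg_exp_coord.
by rewrite [ltRHS]ger0_norm ?addr_ge0 // ltrDl.
Qed.

End FreeSolution.

(** * Steering in continuous time *)

Section CtSufficient.
Import numFieldNormedType.Exports.
Local Open Scope classical_set_scope.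
Variable R : realType.
Local Notation mu := (@lebesgue_measure R).

Lemma is_derive_continuous (F : R -> R) (t c : R) :
  is_derive t (1 : R) F c -> {for t, continuous F}.
Proof.
move=> dF; apply: differentiable_continuous.
by apply/derivable1_diffP; exact: ex_derive.
Qed.

Lemma integrable_segment (f : R -> R) (a c : R) :
  {within `[a, c], continuous f} -> mu.-integrable `[a, c] (EFin \o f).
Proof.
by move=> cf; apply: continuous_compact_integrable => //; exact: segment_compact.
Qed.

Lemma integrable_co (f : R -> \bar R) (a t c : R) : t <= c ->
  mu.-integrable `[a, c] f -> mu.-integrable `[a, t[ f.
Proof.
move=> tc; apply: integrableS; [exact: measurable_itv|exact: measurable_itv|].
by move=> s /=; rewrite !in_itv /= => /andP[-> st]; rewrite (le_trans (ltW st)).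
Qed.

Lemma Rintegral_derive (F g : R -> R) (t : R) :
  (forall s : R, is_derive s (1 : R) F (g s)) -> continuous g -> 0 <= t ->
  F t = F 0 + \int[mu]_(s in `[0, t[) g s.
Proof.
move=> dF cg; rewrite le_eqVlt => /predU1P[<-|t_gt0].
  by rewrite set_itvco0 Rintegral_set0 addr0.
have cF s : {for s, continuous F} by exact: is_derive_continuous (dF s).
have cgw : {within `[0, t], continuous g} by exact: continuous_subspaceT.
rewrite Rintegral_itv_bndo_bndc; last first.
  exact: integrable_co (lexx t) (integrable_segment cgw).
rewrite /Rintegral (@continuous_FTC2 _ g F) //=; first by rewrite subrKC.
- split=> [s _||]; first by have := dF s => /@ex_derive.
  + exact/cvg_at_right_filter/cF.
  + exact/cvg_at_left_filter/cF.
- by move=> s _; rewrite derive1E; have := dF s => /@derive_val.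
Qed.

Variable n' : nat.
Local Notation n := n'.+1.
Variables (A : 'M[R]_n) (b : 'cV[R]_n).

(** Classical solutions are Caratheodory solutions. *)
Lemma smooth_ct_solution (x : R -> 'cV[R]_n) (u : {poly R}) (tf : R) :
  (forall (t : R) i, is_derive t (1 : R) (fun s : R => x s i 0 : R)
     ((A *m x t + u.[t] *: b) i 0)) ->
  ct_solution A b tf (x 0) (fun t => (u.[t])%:M) x.
Proof.
move=> dx; have cx i : continuous (fun s : R => x s i 0 : R).
  by move=> t; exact: is_derive_continuous (dx t i).
split=> [k|i|t i /andP[t_ge0 _]].
- have cu : {within `[0, tf], continuous (horner u)}.
    exact/continuous_subspaceT/continuous_horner.
  apply: integrable_co (lexx tf) _.
  have := integrable_segment cu; apply: eq_integrable => // s _ /=.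
  by rewrite ord1 mxE eqxx mulr1n.
- exact: continuous_subspaceT.
pose g s := \sum_j A i j * x s j 0 + u.[s] * b i 0.
have gE s : g s = (A *m x s + u.[s] *: b) i 0 by rewrite !mxE.
rewrite [RHS](_ : _ = x 0 i 0 + \int[mu]_(s in `[0, t[) g s); last first.
  congr (_ + _); apply: eq_Rintegral => s _.
  by rewrite gE mul_mx_scalar.
apply: (@Rintegral_derive (fun s : R => x s i 0)) => // [s|s].
  by rewrite gE; exact: dx.
apply: cvgD; last by apply: cvgMl; exact: continuous_horner.
apply: cvg_big => [|j _]; first exact: add_continuous.
by apply: cvgMr; exact: cx.
Qed.

(** Superposition of the free motion from x0, on [0, 1], and of c times a
    polynomial motion from the origin to the positive vector w. *)
Lemma krylov_positive_ct : krylov_positive A b -> ct_herdable A b.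
Proof.
move=> [w /krylov_poly_steerable[y [v [yE y0 y1]]] w_gt0] x0 h _.
have [z [z0 dz]] := free_solution A x0.
have [c hc] := pos_scaling (z 1) h w_gt0.
pose x (t : R) : 'cV[R]_n := z t + c *: map_mx (horner^~ t) y.
have xE : x 0 = x0.
  rewrite /x z0 (_ : map_mx _ _ = 0) ?scaler0 ?addr0 //.
  by apply/matrixP => i j; rewrite (ord1 j) !mxE y0.
exists 1, (fun t => ((c *: (v * 'X^0)).[t])%:M), x; split=> //; last first.
  by move=> i; rewrite !mxE y1 hc.
rewrite -{1}xE; apply: smooth_ct_solution => t i.
rewrite (_ : (fun s => x s i 0) =
    (fun s => z s i 0) + c \*: horner (y i 0)); last first.
  by apply/funext => s; rewrite !mxE.
rewrite (_ : (A *m x t + _ *: b) i 0 = (A *m z t) i 0 + c *: (y i 0)^`().[t]).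
  by apply: is_deriveD; apply: is_deriveZ.
rewrite (poly_trajectory_horner _ _ yE) hornerZ /x mulmxDr -scalemxAr.
by rewrite -scalerA -addrA -scalerDr !mxE.
Qed.
End CtSufficient.

(** * States reachable from the origin in continuous time *)

Section CtNecessary.
Import numFieldNormedType.Exports.
Local Open Scope classical_set_scope.
Variable R : realType.
Local Notation mu := (@lebesgue_measure R).

Lemma within_continuous_sum (D : set R) (n : nat) (c : 'I_n -> R)
    (f : 'I_n -> R -> R) : (forall j, {within D, continuous (f j)}) ->
  {within D, continuous (fun s => \sum_j c j * f j s)}.
Proof.
move=> cf s; apply: cvg_big => [|j _]; first exact: add_continuous.
by apply: cvgMr; exact: cf.
Qed.

Lemma Rintegral_lincomb (a t : R) (n : nat) (c : 'I_n -> R)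
    (f : 'I_n -> R -> R) :
  (forall j, mu.-integrable `[a, t[ (EFin \o f j)) ->
  \int[mu]_(s in `[a, t[) (\sum_j c j * f j s) =
  \sum_j c j * \int[mu]_(s in `[a, t[) f j s.
Proof.
move=> f_int; have mD : measurable (`[a, t[ : set (measurableTypeR R)).
  exact: measurable_itv.
have cf_int j : mu.-integrable `[a, t[ (fun s => (c j * f j s)%:E).
  by have := integrableZl mD (c j) (f_int j); apply: eq_integrable.
transitivity (\sum_j \int[mu]_(s in `[a, t[) (c j * f j s)); last first.
  by apply: eq_bigr => j _; apply: RintegralZl.
rewrite /Rintegral sum_fine => [|j _]; last exact: integrable_fin_num.
rewrite -(integral_sum mD cf_int); congr fine.
by apply: eq_integral => s _; rewrite sumEFin.
Qed.

(** A crude Gronwall constant for the derivative of |z|^2 along z' = M z,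
    obtained from 2 |z_i z_j| <= z_i^2 + z_j^2 <= 2 |z|^2. *)
Lemma quadratic_bound (p : nat) (M : 'M[R]_p) (z : 'cV[R]_p) :
  \sum_i 2 * z i 0 * (M *m z) i 0 <=
  (2 * \sum_i \sum_j `|M i j|) * \sum_i z i 0 ^+ 2.
Proof.
set S := \sum_i z i 0 ^+ 2.
have zS i : z i 0 ^+ 2 <= S.
  by rewrite /S (bigD1 i) //= lerDl sumr_ge0 // => j _; exact: sqr_ge0.
have -> : (2 * \sum_i \sum_j `|M i j|) * S = \sum_i \sum_j `|M i j| * (2 * S).
  rewrite mulrAC mulrC mulr_suml; apply: eq_bigr => i _.
  by rewrite mulr_suml.
apply: ler_sum => i _; rewrite mxE mulr_sumr; apply: ler_sum => j _.
rewrite (_ : _ * _ = M i j * (2 * (z i 0 * z j 0))); last by ring.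
rewrite (le_trans (ler_norm _)) // normrM ler_wpM2l // ler_norml.
have := sqr_ge0 (z i 0 - z j 0); have := sqr_ge0 (z i 0 + z j 0).
rewrite sqrrB sqrrD; have := zS i; have := zS j.
set a := z i 0; set b := z j 0 => bS aS hp hm.
by apply/andP; split; lra.
Qed.

(** Uniqueness for y' = M y by an energy estimate: y is differentiable inside
    the interval by the fundamental theorem of calculus, and the choice of c
    in quadratic_bound makes exp(-ct) |y|^2 nonincreasing from the value 0. *)
Lemma linear_integral_eq0 (p : nat) (M : 'M[R]_p) (y : R -> 'cV[R]_p) (T : R) :
  0 < T -> (forall i, {within `[0, T], continuous (fun s : R => y s i 0 : R)}) ->
  (forall (t : R) i, 0 <= t <= T ->
     y t i 0 = \int[mu]_(s in `[0, t[) ((M *m y s) i 0)) ->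
  y T = 0.
Proof.
move=> T_gt0 cy yE.
pose g i s := \sum_j M i j * y s j 0.
have gE i s : (M *m y s) i 0 = g i s by rewrite mxE.
have cg i : {within `[0, T], continuous (g i)}.
  by apply: within_continuous_sum => j; exact: cy.
have ig i : mu.-integrable `[0, T] (EFin \o g i) by exact: integrable_segment.
(* The primitives F i agree with y on [0, T] only, but their derivatives are
   directly given by the fundamental theorem of calculus. *)
pose F i (t : R) := \int[mu]_(s in `[0, t]) g i s.
have FE i t : 0 <= t <= T -> F i t = y t i 0.
  move=> /[dup] tT /andP[_ t_le]; rewrite yE // /F -Rintegral_itv_bndo_bndc.
    by apply: eq_Rintegral => s _; rewrite gE.
  exact: integrable_co t_le (ig i).
have cF i : {within `[0, T], continuous (F i)}.
  exact: parameterized_integral_continuous (ltW T_gt0) (ig i).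
have dF i t : t \in `]0, T[%R -> is_derive t (1 : R) (F i) (g i t).
  move=> /[dup] t0T; rewrite in_itv /= => /andP[t0 tT].
  have [dF F'] := continuous_FTC1_closed tT (ig i) t0
    (within_continuous_continuous T_gt0 (cg i) t0T).
  by apply: DeriveDef; rewrite // -derive1E.
pose c : R := 2 * \sum_i \sum_j `|M i j|.
pose E t := expR (- c * t) * \sum_i F i t ^+ 2.
have dexp t : is_derive t (1 : R) (fun s => expR (- c * s)) (- c * expR (- c * t)).
  rewrite mulrC; apply: is_derive1_comp.
  have := is_deriveZ (- c) (is_derive_id t (1 : R)).
  by rewrite [_ *: _]mulr1.
have dE t : t \in `]0, T[%R -> is_derive t (1 : R) E
    (expR (- c * t) * (\sum_i 2 * F i t * g i t - c * \sum_i F i t ^+ 2)).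
  move=> t0T; rewrite (_ : E =
      (fun s => expR (- c * s)) * (\sum_i F i ^+ 2)); last first.
    by apply/funext => s; rewrite /E /= fct_sumE.
  have dS : is_derive t (1 : R) (\sum_i F i ^+ 2) (\sum_i 2 * F i t * g i t).
    apply: is_derive_sum => i.
    have := is_deriveX 2 (dF i t t0T).
    by rewrite expr1.
  have St : (\sum_i F i ^+ 2) t = \sum_i F i t ^+ 2 by rewrite fct_sumE.
  apply: trigger_derive (is_deriveM (dexp t) dS) _.
  rewrite St /GRing.scale /=; ring.
have E_nincr : E T <= E 0.
  apply: (@ler0_derive1_le_cc _ E 0 T); rewrite ?in_itv /= ?lexx ?ltW //.
  - by move=> t /dE/@ex_derive.
  - move=> t t0T; rewrite derive1E; have /@derive_val -> := dE t t0T.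
    rewrite pmulr_rle0 ?expR_gt0 // subr_le0.
    have tT : 0 <= t <= T.
      by move: t0T; rewrite in_itv /= => /andP[/ltW -> /ltW].
    have := quadratic_bound M (y t); rewrite -/c.
    under eq_bigr do rewrite gE -FE //.
    by under [X in _ <= _ * X]eq_bigr do rewrite -FE //.
  move=> t; apply: cvgM.
    have ce : continuous (fun s => expR (- c * s)).
      by move=> s; exact: is_derive_continuous (dexp s).
    exact: (continuous_subspaceT ce).
  apply: cvg_big => [|i _]; first exact: add_continuous.
  by apply: cvgM; exact: cF.
have E0 : E 0 = 0.
  rewrite /E big1 ?mulr0 // => i _; rewrite FE ?lexx ?ltW // yE ?lexx ?ltW //.
  by rewrite set_itvco0 Rintegral_set0 expr0n.
have : \sum_i F i T ^+ 2 <= 0.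
  by rewrite E0 in E_nincr; rewrite -(pmulr_rle0 _ (expR_gt0 (- c * T))).
move=> S0; apply/matrixP => i j; rewrite (ord1 j) [RHS]mxE.
rewrite -FE ?lexx ?ltW //; apply/eqP; rewrite -sqrf_eq0 -[_ == _]negbK.
apply/negP => Fi; suff : 0 < \sum_i F i T ^+ 2 by rewrite ltNge S0.
rewrite (bigD1 i) //= ltr_pwDl ?sumr_ge0 // => [|k _]; last exact: sqr_ge0.
by rewrite lt_def Fi sqr_ge0.
Qed.

(** Integrability of the right-hand side lets Q pass under the integral, where
    Q (A x + B u) = M (Q x) whatever the input. *)
Lemma ct_krylov_positive (n' : nat) (A : 'M[R]_n'.+1) (b : 'cV[R]_n'.+1) :
  ct_herdable A b -> krylov_positive A b.
Proof.
move=> herd; have [tf [u [x [tf_gt0 [iu cx xE] x_ge1]]]] := herd 0 1 ltr01.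
have [Q [M [QA Qb Qker]]] := krylov_equations A b.
exists (x tf) => [|i]; last exact: lt_le_trans ltr01 (x_ge1 i).
apply: Qker; pose y s := Q *m x s; rewrite -/(y tf).
have yE s i : y s i 0 = \sum_j Q i j * x s j 0 by rewrite mxE.
pose rhs s : 'cV[R]_n'.+1 := A *m x s + b *m u s.
have irhs (t : R) j : 0 <= t <= tf ->
    mu.-integrable `[0, t[ (fun s => (rhs s j 0)%:E).
  move=> /andP[_ t_le].
  rewrite (_ : (fun s => _) = (fun s => (\sum_k A j k * x s k 0)%:E +
      (b j 0)%:E * (u s 0 0)%:E)%E); last first.
    by apply/funext => s; rewrite -EFinM -EFinD !mxE big_ord1.
  apply: integrableD; first exact: measurable_itv.
    apply: integrable_co t_le (integrable_segment _).
    exact: within_continuous_sum.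
  apply: integrableZl; first exact: measurable_itv.
  apply: integrableS (iu 0); [exact: measurable_itv|exact: measurable_itv|].
  by apply: subset_itvl; rewrite bnd_simp.
apply: (linear_integral_eq0 (M := M) tf_gt0) => [i|t i t_in].
  rewrite (_ : (fun s => _) = (fun s => \sum_j Q i j * x s j 0)).
    exact: within_continuous_sum.
  by apply/funext => s; rewrite yE.
rewrite yE.
transitivity (\int[mu]_(s in `[0, t[) (\sum_j Q i j * rhs s j 0)); last first.
  apply: eq_Rintegral => s _.
  have <- : (Q *m rhs s) i 0 = \sum_j Q i j * rhs s j 0 by rewrite mxE.
  by rewrite /rhs mulmxDr !mulmxA QA Qb mul0mx addr0.
transitivity (\sum_j Q i j * \int[mu]_(s in `[0, t[) rhs s j 0).
  by apply: eq_bigr => j _; rewrite xE // mxE add0r.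
rewrite -Rintegral_lincomb // => j; exact: irhs.
Qed.

End CtNecessary.

(** * Signs of the Krylov vectors of a tree of depth two *)

(** Used to prescribe one value per class of first-layer vertices with equal
    squared weight. *)
Lemma interpolation (F : fieldType) (s : seq F) (g : F -> F) :
  exists r : {poly F}, {in s, forall z, r.[z] = g z}.
Proof.
elim: s => [|z s [r rE]]; first by exists 0.
have [zs|zs] := boolP (z \in s).
  by exists r => y; rewrite inE => /predU1P[->|]; apply: rE.
pose q := \prod_(y <- s) ('X - y%:P).
have qz : q.[z] != 0 by move: zs; rewrite -root_prod_XsubC.
exists (r + ((g z - r.[z]) / q.[z]) *: q) => y; rewrite inE !hornerE.
case/predU1P => [->|ys]; first by rewrite divfK // addrC subrK.
have /rootP -> : root q y by rewrite root_prod_XsubC.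
by rewrite mulr0 addr0 rE.
Qed.

Lemma sgr_eq_mul_gt0 (R : realDomainType) (x y : R) :
  x != 0 -> y != 0 -> (Num.sg x == Num.sg y) = (0 < x * y).
Proof.
move=> x0 y0; rewrite -sgr_cp0 sgrM.
by case: (sgrP x) x0 => // _ _; case: (sgrP y) y0 => // _ _;
  rewrite ?mulrNN ?mulr1 ?mul1r ?mulrN1 ?eqxx // [1 == _]eq_sym.
Qed.

Section DepthTwo.
Variables (R : realType) (m1 m2 : nat) (a : 'cV[R]_m1) (W : 'M[R]_(m2, m1)).

(** The weight matrix of a tree of depth two in the decomposition (leader,
    first layer, second layer). *)
Definition depth2_mx : 'M[R]_(1 + (m1 + m2)) :=
  block_mx 0 (row_mx a^T 0) (col_mx a 0) (block_mx 0 W^T W 0).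

Definition layers (c : 'cV[R]_1) (v : 'cV[R]_m1) (y : 'cV[R]_m2) :
  'cV[R]_(1 + (m1 + m2)) := col_mx c (col_mx v y).

Lemma depth2_mxM c v y :
  depth2_mx *m layers c v y = layers (a^T *m v) (a *m c + W^T *m y) (W *m v).
Proof.
rewrite /depth2_mx /layers mul_block_col mul0mx add0r mul_row_col mul0mx addr0.
rewrite mul_col_mx mul_block_col !mul0mx add0r addr0 add_col_mx.
by rewrite add0r.
Qed.

Lemma layersD c v y c' v' y' :
  layers c v y + layers c' v' y' = layers (c + c') (v + v') (y + y').
Proof. by rewrite /layers !add_col_mx. Qed.

Lemma layersZ k c v y : k *: layers c v y = layers (k *: c) (k *: v) (k *: y).
Proof. by rewrite /layers !scale_col_mx. Qed.

Local Notation K := (@in_krylov R (m1 + m2) depth2_mx (layers 1 0 0)).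

Definition sqwt : 'rV[R]_m1 := \row_i \sum_k W k i ^+ 2.

Lemma sqwtE i : sqwt 0 i = \sum_k W k i ^+ 2.
Proof. by rewrite mxE. Qed.

(** Division-free form of: v is proportional to a on each set of indices with
    equal sqwt. *)
Definition proportional (v : 'cV[R]_m1) : Prop :=
  forall i j, sqwt 0 i = sqwt 0 j -> v i 0 * a j 0 = v j 0 * a i 0.

Hypothesis one_parent : forall k i j, W k i != 0 -> W k j != 0 -> i = j.

(** Distinct columns of W have disjoint supports. *)
Lemma gram_diag : W^T *m W = diag_mx sqwt.
Proof.
apply/matrixP => i j; rewrite !mxE; case: (eqVneq i j) => [<-|ij].
  by rewrite mulr1n; apply: eq_bigr => k _; rewrite mxE expr2.
rewrite mulr0n big1 // => k _; rewrite mxE.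
have [->|Wi] := eqVneq (W k i) 0; first by rewrite mul0r.
have [->|Wj] := eqVneq (W k j) 0; first by rewrite mulr0.
by rewrite (one_parent Wi Wj) eqxx in ij.
Qed.

Lemma gramM (v : 'cV[R]_m1) i : (W^T *m (W *m v)) i 0 = sqwt 0 i * v i 0.
Proof. by rewrite mulmxA gram_diag mul_diag_mx [LHS]mxE. Qed.

(** The vectors of this form are a subspace that contains the generator and is
    stable under the matrix: the diagonal matrix W^T W preserves proportional
    vectors. *)
Lemma krylov_layers x : K x -> exists c v w,
  [/\ x = layers c v (W *m w), proportional v & proportional w].
Proof.
have pD v v' : proportional v -> proportional v' -> proportional (v + v').
  by move=> pv pv' i j ij; rewrite !mxE !mulrDl pv // pv'.
have pZ k v : proportional v -> proportional (k *: v).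
  by move=> pv i j ij; rewrite !mxE -!mulrA pv.
have p0 : proportional 0 by move=> i j _; rewrite !mxE !mul0r.
have pa : proportional a by move=> i j _; rewrite mulrC.
have pg v : proportional v -> proportional (W^T *m (W *m v)).
  by move=> pv i j ij; rewrite !gramM ij -!mulrA pv.
move: x; apply: in_krylov_ind.
- by exists 1, 0, 0; rewrite mulmx0.
- by exists 0, 0, 0; rewrite mulmx0 /layers !col_mx0.
- move=> _ _ [c [v [w [-> pv pw]]]] [c' [v' [w' [-> pv' pw']]]].
  exists (c + c'), (v + v'), (w + w').
  by rewrite layersD mulmxDr; split=> //; apply: pD.
- move=> k _ [c [v [w [-> pv pw]]]].
  exists (k *: c), (k *: v), (k *: w).
  by rewrite layersZ scalemxAr; split=> //; apply: pZ.
move=> _ [c [v [w [-> pv pw]]]].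
exists (a^T *m v), (a *m c + W^T *m (W *m w)), v.
rewrite depth2_mxM; split=> //; apply: pD; last exact: pg.
by rewrite [c]mx11_scalar mul_mx_scalar; apply: pZ.
Qed.

(** Multiplying (0, v, 0) by the matrix gives (a^T v, 0, W v), whose first
    entry is removed with the generator. *)
Lemma krylov_layer2 v : K (layers 0 v 0) -> K (layers 0 0 (W *m v)).
Proof.
move=> Kv; rewrite (_ : layers 0 0 _ = depth2_mx *m layers 0 v 0 +
    - (a^T *m v) 0 0 *: layers 1 0 0).
  apply: in_krylovD; first exact: (@in_krylovM R (m1 + m2)).
  exact/in_krylovZ/in_krylov_gen.
rewrite depth2_mxM layersZ layersD !mulmx0 !scaler0 !addr0; congr layers.
by rewrite scaleNr {1}[a^T *m v]mx11_scalar scalemx1 subrr.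
Qed.

Definition eval_sqwt (r : {poly R}) : 'cV[R]_m1 :=
  \col_i (r.[sqwt 0 i] * a i 0).

(** A step down followed by a step up multiplies the first layer by W^T W, so
    all vectors diag(sqwt)^k a occur there. *)
Lemma krylov_layer1 r : K (layers 0 (eval_sqwt r) 0).
Proof.
pose e k : 'cV[R]_m1 := \col_i (sqwt 0 i ^+ k * a i 0).
have Ke k : K (layers 0 (e k) 0).
  elim: k => [|k IH].
    rewrite (_ : layers 0 _ _ = depth2_mx *m layers 1 0 0).
      exact/in_krylovM/in_krylov_gen.
    rewrite depth2_mxM !mulmx0 addr0 mulmx1; congr layers.
    by apply/matrixP => i j; rewrite (ord1 j) mxE expr0 mul1r.
  rewrite (_ : layers 0 _ _ = depth2_mx *m layers 0 0 (W *m e k)).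
    exact/(@in_krylovM R (m1 + m2))/krylov_layer2.
  rewrite depth2_mxM !mulmx0 add0r; congr layers.
  apply/matrixP => i j; rewrite (ord1 j) gramM [LHS]mxE [X in _ = _ * X]mxE.
  by rewrite exprS mulrA.
rewrite (_ : layers 0 _ _ = \sum_(k < size r) r`_k *: layers 0 (e k) 0).
  by apply: in_krylov_sum => k; apply: in_krylovZ.
transitivity (layers 0 (\sum_(k < size r) r`_k *: e k) 0).
  congr layers; apply/matrixP => i j; rewrite !mxE summxE horner_coef mulr_suml.
  by apply: eq_bigr => k _; rewrite !mxE mulrA.
rewrite (big_morph (fun v => layers 0 v 0) (id1 := 0) (op1 := +%R)).
- by apply: eq_bigr => k _; rewrite layersZ !scaler0.
- by move=> v v'; rewrite layersD !addr0.
- by rewrite /layers !col_mx0.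
Qed.

Hypothesis has_parent : forall k, exists i, W k i != 0.
Hypothesis a_neq0 : forall i, a i 0 != 0.

Lemma mulW_entry (v : 'cV[R]_m1) k i : W k i != 0 ->
  (W *m v) k 0 = W k i * v i 0.
Proof.
move=> Wki; rewrite mxE (bigD1 i) //= big1 ?addr0 // => j ji.
have [->|Wkj] := eqVneq (W k j) 0; first by rewrite mul0r.
by rewrite (one_parent Wkj Wki) eqxx in ji.
Qed.

Definition sign_condition := forall i j, sqwt 0 i = sqwt 0 j ->
  0 < a i 0 * a j 0 /\
  (W *m (basis_vec R i + basis_vec R j) = 0 \/
   unisigned (W *m (basis_vec R i + basis_vec R j))).

(** The two columns do not interfere at k unless i = j, where the entry is
    only doubled. *)
Lemma sg_col_pair i j k : W k i != 0 ->
  Num.sg ((W *m (basis_vec R i + basis_vec R j)) k 0) = Num.sg (W k i).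
Proof.
move=> Wki; rewrite (mulW_entry _ Wki) !mxE !eqxx andbT.
by rewrite sgrM [X in _ * X]gtr0_sg ?mulr1 // ltr_pwDl ?ler0n ?ltr01.
Qed.

Lemma col_pair_neq0 i j k :
  (W *m (basis_vec R i + basis_vec R j)) k 0 != 0 -> W k i != 0 \/ W k j != 0.
Proof.
move=> yk; apply/orP; apply: contraNT yk; rewrite negb_or !negbK.
by rewrite mulmxDr -!colE !mxE => /andP[/eqP-> /eqP->]; rewrite addr0.
Qed.

(** A positive v with v_i a_j = v_j a_i gives v_i a_j^2 = v_j a_i a_j, hence
    the sign of a_i a_j.  Then w too has one sign on the class of i and j, and
    positivity of W w transmits it to all edges going down from i and j. *)
Lemma krylov_positive_sign :
  @krylov_positive R (m1 + m2) depth2_mx (layers 1 0 0) -> sign_condition.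
Proof.
move=> [x /krylov_layers[c [v [w [-> pv pw]]]] x_gt0'] i j ij.
have x_gt0 (s : 'I_(1 + (m1 + m2))) : 0 < layers c v (W *m w) s 0.
  exact: x_gt0'.
have v_gt0 l : 0 < v l 0.
  by have := x_gt0 (follower1 m2 l); rewrite /layers /follower1 col_mxEd col_mxEu.
have w_gt0 k l : W k l != 0 -> 0 < W k l * w l 0.
  move=> Wkl; have := x_gt0 (follower2 m1 k).
  by rewrite /layers /follower2 !col_mxEd (mulW_entry _ Wkl).
have a_gt0 : 0 < a i 0 * a j 0.
  rewrite -(pmulr_rgt0 _ (v_gt0 i)) mulrCA pv // mulrCA -expr2.
  by rewrite pmulr_rgt0 // lt_def sqrf_eq0 a_neq0 sqr_ge0.
have w_sg : Num.sg (w j 0) = Num.sg (w i 0).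
  have := congr1 Num.sg (pw i j ij); rewrite !sgrM.
  have /eqP -> : Num.sg (a i 0) == Num.sg (a j 0) by rewrite sgr_eq_mul_gt0.
  by move/mulIf => -> //; rewrite sgr_eq0.
have sgW k l : W k l != 0 -> Num.sg (W k l) = Num.sg (w l 0).
  move=> Wkl; apply/eqP; rewrite sgr_eq_mul_gt0 ?w_gt0 //.
  by apply: contraTneq (w_gt0 _ _ Wkl) => ->; rewrite mulr0 ltxx.
split=> //; set y := W *m _.
have yE k : y k 0 != 0 -> Num.sg (y k 0) = Num.sg (w i 0).
  case/col_pair_neq0 => Wk; first by rewrite sg_col_pair // sgW.
  by rewrite /y addrC sg_col_pair // sgW.
have [y0|y0] := eqVneq y 0; [by left|right; split=> // k l yk yl].
by rewrite !yE.
Qed.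

(** The positive vector is (1, |a|, W w), where w_i is a_i up to the sign that
    the edges going down from i dictate, and 0 if there are none. *)
Lemma sign_krylov_positive :
  sign_condition -> @krylov_positive R (m1 + m2) depth2_mx (layers 1 0 0).
Proof.
move=> cond.
have a_sg i j : sqwt 0 i = sqwt 0 j -> Num.sg (a i 0) = Num.sg (a j 0).
  by move=> /cond[aij _]; apply/eqP; rewrite sgr_eq_mul_gt0.
have W_sg k l i j : sqwt 0 i = sqwt 0 j -> W k i != 0 -> W l j != 0 ->
    Num.sg (W k i) = Num.sg (W l j).
  move=> /cond[_ Wij] Wki Wlj.
  rewrite -(sg_col_pair j Wki) -(sg_col_pair i Wlj) [basis_vec _ j + _]addrC.
  set y := W *m _ in Wij *.
  have yk : y k 0 != 0 by rewrite -sgr_eq0 sg_col_pair // sgr_eq0.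
  have yl : y l 0 != 0 by rewrite /y addrC -sgr_eq0 sg_col_pair // sgr_eq0.
  case: Wij => [y0|[_ ysg]]; last exact: ysg.
  by rewrite y0 mxE eqxx in yk.
pose s := [seq sqwt 0 i | i : 'I_m1].
have sP i : sqwt 0 i \in s by apply/mapP; exists i; rewrite ?mem_enum.
(* Interpolation needs the signs as functions of the value of sqwt; by a_sg and
   W_sg the choice of a representative of the class is harmless. *)
pose f z := if [pick i | sqwt 0 i == z] is Some i then Num.sg (a i 0) else 0.
have fE i : f (sqwt 0 i) = Num.sg (a i 0).
  by rewrite /f; case: pickP => [j /eqP/a_sg//|/(_ i)]; rewrite eqxx.
(* g z is chosen so that g z * a_i has the sign of the edges going down from the
   class of i.  The value 0 is taken only on classes without such edges, where
   the entries of the vector do not matter. *)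
pose g z := if [pick p : 'I_m2 * 'I_m1 | (sqwt 0 p.2 == z) && (W p.1 p.2 != 0)]
  is Some p then Num.sg (W p.1 p.2) * f z else 0.
have gE k i : W k i != 0 -> g (sqwt 0 i) = Num.sg (W k i) * Num.sg (a i 0).
  rewrite /g fE; case: pickP => [[l j] /= /andP[/eqP ji Wlj] Wki|].
    by rewrite (W_sg l k j i).
  by move=> /(_ (k, i)) /=; rewrite eqxx /= => ->.
have [p pE] := interpolation s f; have [q qE] := interpolation s g.
exists (layers 1 (eval_sqwt p) (W *m eval_sqwt q)).
  rewrite (_ : layers 1 (eval_sqwt p) _ =
      layers 1 0 0 + layers 0 (eval_sqwt p) 0 + layers 0 0 (W *m eval_sqwt q)).
    apply: in_krylovD; last exact/krylov_layer2/krylov_layer1.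
    apply: in_krylovD; last exact: krylov_layer1.
    exact: in_krylov_gen.
  by rewrite !layersD !addr0 !add0r.
suff pos (i : 'I_(1 + (m1 + m2))) :
    0 < layers 1 (eval_sqwt p) (W *m eval_sqwt q) i 0 by exact: pos.
rewrite /layers; case: (split_ordP i) => [{}i ->|{}i ->].
  by rewrite (ord1 i) col_mxEu mxE eqxx ltr01.
rewrite col_mxEd; case: (split_ordP i) => [{}i ->|k ->].
  by rewrite col_mxEu mxE pE ?fE // -normrEsg normr_gt0.
have [j Wkj] := has_parent k.
rewrite col_mxEd (mulW_entry _ Wkj) mxE qE ?(gE k) //.
by rewrite -mulrA -normrEsg mulrA [W k j * _]mulrC -normrEsg mulr_gt0 ?normr_gt0.
Qed.
End DepthTwo.

(** * Trees with all vertices within distance two of a root *)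

Section Tree.
Variables (R : realType) (m1 m2 : nat) (A : 'M[R]_(1 + (m1 + m2))).
Hypothesis A_sym : A^T = A.
Hypothesis A_acyclic : graph_acyclic (mx_arc A).
Hypothesis dist_F1 : forall i : 'I_m1,
  is_distance (mx_arc A) (leader m1 m2) (follower1 m2 i) 1.
Hypothesis dist_F2 : forall k : 'I_m2,
  is_distance (mx_arc A) (leader m1 m2) (follower2 m1 k) 2.

Local Notation e := (mx_arc A).
Local Notation r := (leader m1 m2).
Local Notation f1 := (@follower1 m1 m2).
Local Notation f2 := (@follower2 m1 m2).

Lemma mx_sym x y : A x y = A y x.
Proof. by rewrite -{1}A_sym mxE. Qed.

Lemma arc_sym x y : e x y = e y x.
Proof. by rewrite /mx_arc mx_sym. Qed.

Lemma arc_irr x : e x x = false.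
Proof. by apply/negbTE; have [] := A_acyclic. Qed.

Lemma no_cycle c : (2 < size c)%N -> cycle e c -> uniq c -> False.
Proof. by move=> sc cc uc; apply: (A_acyclic.2 c sc); rewrite /ucycle cc. Qed.

Lemma arc_leader_f1 i : e r (f1 i).
Proof.
have [[p [ep lp sp]] _] := dist_F1 i.
by case: p sp ep lp => [|y [|]] //= _ /andP[ey _] <-.
Qed.

Lemma arc_leader_f2 k : e r (f2 k) = false.
Proof.
case: (boolP (e r (f2 k))) => // ek.
have [_ /(_ [:: f2 k]) d2] := dist_F2 k.
have ep : path e r [:: f2 k] by rewrite /= ek.
by have := d2 ep erefl.
Qed.

Variant vertex_spec : 'I_(1 + (m1 + m2)) -> Type :=
  | VertexLeader : vertex_spec r
  | VertexF1 i : vertex_spec (f1 i)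
  | VertexF2 k : vertex_spec (f2 k).

Lemma vertexP x : vertex_spec x.
Proof.
case: (split_ordP x) => [i ->|y ->].
  by rewrite ord1; exact: VertexLeader.
by case: (split_ordP y) => [i ->|k ->]; [exact: VertexF1|exact: VertexF2].
Qed.

Lemma f2_parent k : exists i, e (f1 i) (f2 k).
Proof.
have [[p [ep lp sp]] _] := dist_F2 k.
case: p sp ep lp => [|x [|y []]] //= _ /and3P[ex ey _] yE; subst y.
case: (vertexP x) ex ey => [|i|l]; first by rewrite arc_irr.
- by exists i.
- by rewrite arc_leader_f2.
Qed.

Lemma f1_inj : injective f1.
Proof. by move=> i j /rshift_inj/lshift_inj. Qed.

Lemma f2_inj : injective f2.
Proof. by move=> i j /rshift_inj/rshift_inj. Qed.

Lemma leader_f1 i : (r == f1 i) = false.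
Proof. by rewrite eq_lrshift. Qed.

Lemma leader_f2 k : (r == f2 k) = false.
Proof. by rewrite eq_lrshift. Qed.

Lemma f1_f2 i k : (f1 i == f2 k) = false.
Proof. by rewrite /follower1 /follower2 eq_rshift eq_lrshift. Qed.

Let vE := (leader_f1, leader_f2, f1_f2, (inj_eq f1_inj), (inj_eq f2_inj),
  in_cons, in_nil, orbF).

Lemma arc_f1_f1 i j : e (f1 i) (f1 j) = false.
Proof.
case: (boolP (e (f1 i) (f1 j))) => // ij; exfalso; have nij : i != j.
  by apply: contraTneq ij => ->; rewrite arc_irr.
apply: (@no_cycle [:: r; f1 i; f1 j]) => //=.
  by rewrite arc_leader_f1 ij arc_sym arc_leader_f1.
by rewrite !vE nij.
Qed.

Lemma f2_parent_uniq k i j : e (f1 i) (f2 k) -> e (f1 j) (f2 k) -> i = j.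
Proof.
move=> ik jk; apply/eqP/negP => /negP nij.
apply: (@no_cycle [:: r; f1 i; f2 k; f1 j]) => //=.
  by rewrite !arc_leader_f1 ik arc_sym jk arc_sym arc_leader_f1.
by rewrite !vE [f2 _ == f1 _]eq_sym !vE (negbTE nij).
Qed.

Lemma arc_f2_f2 k l : e (f2 k) (f2 l) = false.
Proof.
case: (boolP (e (f2 k) (f2 l))) => // kl; exfalso; have nkl : k != l.
  by apply: contraTneq kl => ->; rewrite arc_irr.
have [[i ik] [j jl]] := (f2_parent k, f2_parent l).
have [ij|nij] := eqVneq i j.
  apply: (@no_cycle [:: f1 i; f2 k; f2 l]) => //=.
    by rewrite ik kl arc_sym ij jl.
  by rewrite !vE nkl.
apply: (@no_cycle [:: r; f1 i; f2 k; f2 l; f1 j]) => //=.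
  by rewrite !arc_leader_f1 ik kl arc_sym jl arc_sym arc_leader_f1.
by rewrite !vE ![f2 _ == f1 _]eq_sym !vE (negbTE nij) (negbTE nkl).
Qed.

Lemma block21E i : block21 A i 0 = A (f1 i) r.
Proof. by rewrite !mxE. Qed.

Lemma block32E k i : block32 A k i = A (f2 k) (f1 i).
Proof. by rewrite !mxE. Qed.

Lemma arcPn x y : e x y = false -> A x y = 0.
Proof. by rewrite arc_sym => /negbFE/eqP. Qed.

(** The zero blocks come from the distances (leader to second layer) and from
    acyclicity: an edge inside a layer would close a cycle through the
    neighbours of its ends in the layers above. *)
Lemma tree_depth2 : A = depth2_mx (block21 A) (block32 A).
Proof.
have Af2r k : A (f2 k) r = 0 by apply: arcPn; rewrite arc_sym arc_leader_f2.
apply/matrixP => x y; case: (vertexP x) => [|i|k]; case: (vertexP y) => [|j|l].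
- by rewrite /depth2_mx block_mxEul mxE arcPn ?arc_irr.
- rewrite /depth2_mx /follower1 block_mxEur row_mxEl mxE block21E.
  exact: mx_sym.
- by rewrite /depth2_mx /follower2 block_mxEur row_mxEr mxE arcPn ?arc_leader_f2.
- by rewrite /depth2_mx /follower1 block_mxEdl col_mxEu block21E.
- by rewrite /depth2_mx /follower1 block_mxEdr block_mxEul mxE arcPn ?arc_f1_f1.
- rewrite /depth2_mx /follower1 /follower2 block_mxEdr block_mxEur mxE block32E.
  exact: mx_sym.
- by rewrite /depth2_mx /follower2 block_mxEdl col_mxEd mxE Af2r.
- by rewrite /depth2_mx /follower1 /follower2 block_mxEdr block_mxEdl block32E.
- by rewrite /depth2_mx /follower2 block_mxEdr block_mxEdr mxE arcPn ?arc_f2_f2.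
Qed.

Lemma block23_tr : block23 A = (block32 A)^T.
Proof.
by apply/matrixP => i k; rewrite [RHS]mxE block32E mx_sym !mxE.
Qed.

Lemma tree_sign_condition :
  sign_condition (block21 A) (block32 A) <->
  (forall i j : 'I_m1,
      [/\ (block23 A *m block32 A) i i = \sum_(k < m2) block32 A k i ^+ 2,
          \sum_(k < m2) block32 A k i ^+ 2 = \sum_(k < m2) block32 A k j ^+ 2 &
          \sum_(k < m2) block32 A k j ^+ 2 = (block23 A *m block32 A) j j] ->
      0 < block21 A i 0 * block21 A j 0 /\
      (block32 A *m (basis_vec R i + basis_vec R j) = 0 \/
       unisigned (block32 A *m (basis_vec R i + basis_vec R j)))).
Proof.
have gE i : (block23 A *m block32 A) i i = \sum_(k < m2) block32 A k i ^+ 2.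
  by rewrite block23_tr mxE; apply: eq_bigr => k _; rewrite mxE expr2.
split=> cond i j; first by case=> _ ij _; apply: cond; rewrite !sqwtE.
by rewrite !sqwtE => ij; apply: cond; rewrite !gE.
Qed.

Lemma tree_krylov_positive :
  @krylov_positive R (m1 + m2) A (basis_vec R r) <->
  sign_condition (block21 A) (block32 A).
Proof.
have -> : basis_vec R r = layers 1 0 0.
  apply/matrixP => x j; rewrite ord1 mxE andbT /layers.
  case: (vertexP x) => [|i|k]; first by rewrite col_mxEu mxE eqxx.
  - by rewrite eq_sym leader_f1 col_mxEd col_mxEu mxE.
  - by rewrite eq_sym leader_f2 !col_mxEd mxE.
rewrite [X in @krylov_positive _ _ X]tree_depth2.
have up k i j : block32 A k i != 0 -> block32 A k j != 0 -> i = j.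
  by rewrite !block32E => ki kj; apply: (@f2_parent_uniq k).
split; first apply: krylov_positive_sign => // i.
  by rewrite block21E; exact: arc_leader_f1.
apply: sign_krylov_positive => // [k|i].
  by have [i ik] := f2_parent k; exists i; rewrite block32E.
by rewrite block21E; exact: arc_leader_f1.
Qed.
End Tree.

(** * The criterion *)

Theorem proposition14 (R : realType) (m1 m2 : nat)
    (A : 'M[R]_(1 + (m1 + m2)))
    (A_sym : A^T = A)
    (A_connected : graph_connected (mx_arc A))
    (A_acyclic : graph_acyclic (mx_arc A))
    (dist_F1 : forall i : 'I_m1,
       is_distance (mx_arc A) (leader m1 m2) (follower1 m2 i) 1)
    (dist_F2 : forall k : 'I_m2,
       is_distance (mx_arc A) (leader m1 m2) (follower2 m1 k) 2) :
  let B : 'cV[R]_(1 + (m1 + m2)) := basis_vec R (leader m1 m2) in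
  let A21 := block21 A in
  let A23 := block23 A in
  let A32 := block32 A in
  let condition :=
    forall i j : 'I_m1,
      [/\ (A23 *m A32) i i = \sum_(k < m2) A32 k i ^+ 2,
          \sum_(k < m2) A32 k i ^+ 2 = \sum_(k < m2) A32 k j ^+ 2 &
          \sum_(k < m2) A32 k j ^+ 2 = (A23 *m A32) j j] ->
      0 < A21 i 0 * A21 j 0 /\
      (A32 *m (basis_vec R i + basis_vec R j) = 0 \/
       unisigned (A32 *m (basis_vec R i + basis_vec R j))) in
  (ct_herdable A B <-> condition) /\ (dt_herdable A B <-> condition).
Proof.
move=> B A21 A23 A32 condition.
have krylovE : @krylov_positive R (m1 + m2) A B <-> condition.
  rewrite (tree_krylov_positive A_sym A_acyclic dist_F1 dist_F2).
  exact: tree_sign_condition.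
split; rewrite -krylovE; last exact: dt_herdableP.
split; first exact: (@ct_krylov_positive R (m1 + m2)).
exact: (@krylov_positive_ct R (m1 + m2)).
Qed.
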